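(* Let $f$ be analytic in $\mathbb{D}$ with $f(0)=0$ and $f'(0)=1$. If $$\operatorname{Re}\left(f'(z)+zf''(z)\right)>0\quad\text{for all }z\in\mathbb{D},$$ then $f$ is univalent in $\mathbb{D}$ and, in fact, $\operatorname{Re}f'(z)>2\log2-1$ for all $z\in\mathbb{D}$.
   Context: $\mathbb{D}=\{z\in\mathbb{C}:|z|<1\}$; univalent means injective. *)

(* Defs.v *)
From Stdlib Require Import Reals.
From Coquelicot Require Import Coquelicot.

Local Open Scope R_scope.

Definition unit_disc (z : C) : Prop := Cmod z < 1.

(** Local representability by a convergent complex power series. *)
Definition analytic_at (f : C -> C) (z : C) : Prop :=
  exists (a : nat -> C) (r : R), 0 < r /\
    forall w : C, Cmod (w - z)%C < r ->
      @is_pseries C_AbsRing C_NormedModule a (w - z)%C (f w).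

Definition analytic_on (D : C -> Prop) (f : C -> C) : Prop :=
  forall z : C, D z -> analytic_at f z.

Definition univalent_on (D : C -> Prop) (f : C -> C) : Prop :=
  forall z w : C, D z -> D w -> f z = f w -> z = w.

(* Main.v *)
(** The function p = f' + z f'' = (z f')' has positive real part and p(0) = 1, so
    Schwarz's lemma for (p - 1)/(p + 1) gives Re p(z) >= (1 - |z|)/(1 + |z|).
    Integrating p along the ray from 0 to z, with r = |z|, gives
    Re f'(z) >= 2 ln(1 + r)/r - 1 > 2 ln 2 - 1 by concavity of ln.  In particular
    Re f' > 0, which on a convex domain forces injectivity.
    Schwarz's lemma rests on the weak maximum principle: ln |h|^2 is harmonic where
    h is analytic and nonzero, and a function with positive Laplacian has no
    interior maximum. *)

Require Import Defs.
From Stdlib Require Import Reals Lra ClassicalEpsilon List.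
From Coquelicot Require Import Coquelicot.
Local Open Scope R_scope.

(** Schwarz's lemma is the only deep step. The obstacle is the quotient phi = (p - 1)/(p + 1),
    further divided by z: it enters only through ln |phi|^2 - beta ln |z|^2, which splits into ln |p
    - 1|^2, ln |p + 1|^2 and ln |z|^2. Analyticity then has to be propagated only through
    derivatives, sums and multiplication by z. A small multiple of |z|^2 is added to make the
    Laplacian strictly positive, so that the second-derivative test along the two axes already
    excludes an interior maximum.

    Analyticity at a point is a power series about that point. Termwise differentiation shows that f
    has a derivative on the whole disc of this series and that the derivative is a power series
    about the same centre, on the same disc. *)

(** * Complex derivatives and termwise differentiation of power series *)

Lemma is_derive_C_iff (f : C -> C) (z l : C) :
  @is_derive C_AbsRing C_NormedModule f z l <->
  forall eps : R, 0 < eps -> exists d : R, 0 < d /\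
    forall w : C, Cmod (w - z) < d ->
      Cmod (f w - f z - (w - z) * l)%C <= eps * Cmod (w - z).
Proof.
  split.
  - intros [_ H] eps Heps.
    assert (L : is_filter_lim (@locally (AbsRing_UniformSpace C_AbsRing) z) z)
      by (intros P HP; exact HP).
    destruct (H z L (mkposreal eps Heps)) as [d Hd].
    exists d; split; [apply cond_pos|].
    intros w Hw; exact (Hd w Hw).
  - intros H; split.
    { apply is_linear_scal_l. }
    intros x Hx.
    assert (E : z = x) by exact (@is_filter_lim_locally_unique _ (AbsRing_NormedModule C_AbsRing) z x Hx).
    subst x; intros eps.
    destruct (H eps (cond_pos eps)) as [d [Hd Hw]].
    exists (mkposreal d Hd); intros w Hwd; exact (Hw w Hwd).
Qed.

Lemma Cmod_series_le (u : nat -> C) (b : nat -> R) (l : C) (s : R) :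
  @is_series C_AbsRing C_NormedModule u l ->
  (forall n, Cmod (u n) <= b n) -> is_series b s -> Cmod l <= s.
Proof.
  intros Hu Hb Hs.
  assert (H1 : is_lim_seq (fun n => Cmod (sum_n u n)) (Cmod l)).
  { apply (filterlim_comp _ _ _ (sum_n u) (@norm C_AbsRing C_NormedModule) _ _ _ Hu).
    apply (@filterlim_norm C_AbsRing C_NormedModule). }
  apply (is_lim_seq_le (fun n => Cmod (sum_n u n)) (sum_n b) (Cmod l) s); [|exact H1|exact Hs].
  intros n; induction n.
  - rewrite !sum_O; apply Hb.
  - rewrite !sum_Sn.
    eapply Rle_trans; [apply Cmod_triangle|].
    apply Rplus_le_compat; [exact IHn|apply Hb].
Qed.

Lemma pow_n_Cpow (x : C) (n : nat) : @pow_n C_Ring x n = Cpow x n.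
Proof.
  induction n; [reflexivity|].
  change (Cmult x (@pow_n C_Ring x n) = Cmult x (Cpow x n)).
  rewrite IHn; reflexivity.
Qed.

Lemma is_pseries_C_iff (a : nat -> C) (x l : C) :
  @is_pseries C_AbsRing C_NormedModule a x l <->
  @is_series C_AbsRing C_NormedModule (fun n => x ^ n * a n)%C l.
Proof.
  unfold is_pseries; split; apply is_series_ext; intros n.
  - exact (f_equal (fun y => Cmult y (a n)) (pow_n_Cpow x n)).
  - exact (f_equal (fun y => Cmult y (a n)) (eq_sym (pow_n_Cpow x n))).
Qed.

(** The terms of a convergent series are bounded. This hands the coefficient moduli over to the
    theory of real power series, which then supplies the majorants. *)
Lemma CV_radius_Cmod_ge (a : nat -> C) (x l : C) :
  @is_pseries C_AbsRing C_NormedModule a x l ->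
  Rbar_le (Cmod x) (CV_radius (fun n => Cmod (a n))).
Proof.
  intros H; apply is_pseries_C_iff in H.
  set (u := fun n : nat => (x ^ n * a n)%C) in H.
  assert (H1 : is_lim_seq (fun n => Cmod (sum_n u n)) (Cmod l)).
  { apply (filterlim_comp _ _ _ (sum_n u) (@norm C_AbsRing C_NormedModule) _ _ _ H).
    apply (@filterlim_norm C_AbsRing C_NormedModule). }
  apply is_lim_seq_Reals in H1.
  destruct (maj_by_pos _ (exist _ _ H1)) as [M [HM HB]].
  apply (proj1 (CV_radius_bounded (fun n => Cmod (a n)))).
  (* Each term is a difference of two partial sums, and [M] bounds every partial sum. *)
  exists (M + M); intros n.
  assert (HB' : forall k, Cmod (sum_n u k) <= M).
  { intros k; eapply Rle_trans; [apply Rle_abs|apply HB]. }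
  replace (Rabs (Cmod (a n) * Cmod x ^ n)) with (Cmod (u n)).
  2:{ unfold u; rewrite Cmod_mult, Cmod_pow, Rabs_pos_eq; [ring|].
      apply Rmult_le_pos; [apply Cmod_ge_0|apply pow_le, Cmod_ge_0]. }
  destruct n.
  - generalize (HB' 0%nat); rewrite sum_O; lra.
  - replace (u (S n)) with (sum_n u (S n) - sum_n u n)%C
      by (rewrite sum_Sn; change plus with Cplus; ring).
    unfold Cminus; eapply Rle_trans; [apply Cmod_triangle|].
    rewrite Cmod_opp; apply Rplus_le_compat; apply HB'.
Qed.

(** The remainders R_n satisfy R_(n+1) = (x + h) R_n + (n + 1) x^n h^2. The weight n (n + 1), twice
    the sharp one, is exactly the factor produced by differentiating a power series twice. *)
Lemma Cpow_taylor2_le (x h : C) (rho : R) (n : nat) :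
  Cmod x <= rho -> Cmod (x + h) <= rho ->
  Cmod ((x + h) ^ S n - x ^ S n - RtoC (INR (S n)) * x ^ n * h)%C
    <= INR n * INR (S n) * rho ^ pred n * Cmod h ^ 2.
Proof.
  intros Hx Hxh.
  assert (Hr : 0 <= rho) by (eapply Rle_trans; [apply Cmod_ge_0|exact Hx]).
  induction n.
  - replace ((x + h) ^ 1 - x ^ 1 - RtoC (INR 1) * x ^ 0 * h)%C with (RtoC 0).
    + rewrite Cmod_0; simpl; lra.
    + simpl; ring.
  - replace ((x + h) ^ S (S n) - x ^ S (S n) - RtoC (INR (S (S n))) * x ^ S n * h)%C
      with ((x + h) * ((x + h) ^ S n - x ^ S n - RtoC (INR (S n)) * x ^ n * h)
            + RtoC (INR (S n)) * x ^ n * h ^ 2)%C.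
    2:{ rewrite (S_INR (S n)), RtoC_plus; simpl; ring. }
    eapply Rle_trans; [apply Cmod_triangle|].
    rewrite !Cmod_mult, !Cmod_pow, Cmod_R, (Rabs_pos_eq _ (pos_INR _)).
    assert (H1 : Cmod (x + h) * Cmod ((x + h) ^ S n - x ^ S n - RtoC (INR (S n)) * x ^ n * h)
       <= rho * (INR n * INR (S n) * rho ^ pred n * Cmod h ^ 2)).
    { apply Rmult_le_compat; try apply Cmod_ge_0; assumption. }
    assert (H2 : INR (S n) * Cmod x ^ n * Cmod h ^ 2 <= INR (S n) * rho ^ n * Cmod h ^ 2).
    { apply Rmult_le_compat_r; [apply pow_le, Cmod_ge_0|].
      apply Rmult_le_compat_l; [apply pos_INR|].
      apply pow_incr; split; [apply Cmod_ge_0|assumption]. }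
    assert (H3 : 0 <= INR (S n) * rho ^ n * Cmod h ^ 2).
    { repeat apply Rmult_le_pos; first [apply pos_INR|apply Cmod_ge_0|apply pow_le; assumption|lra]. }
    assert (H4 : rho * (INR n * INR (S n) * rho ^ pred n * Cmod h ^ 2)
                 = INR n * (INR (S n) * rho ^ n * Cmod h ^ 2)).
    { destruct n; [simpl; ring|]; change (pred (S n)) with n; change (rho ^ S n) with (rho * rho ^ n); ring. }
    change (pred (S n)) with n.
    replace (INR (S n) * INR (S (S n)) * rho ^ n * Cmod h ^ 2)
      with (INR (S (S n)) * (INR (S n) * rho ^ n * Cmod h ^ 2)) by ring.
    rewrite (S_INR (S n)), (S_INR n) in *; lra.
Qed.

Definition Cps_derive (a : nat -> C) (n : nat) : C := (RtoC (INR (S n)) * a (S n))%C.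

(** The second-order remainders of the terms sum to at most M |h|^2, where M is the twice
    differentiated majorant series at a radius [rho] between |w - z0| and r. *)
Lemma Cpseries_derive (a : nat -> C) (z0 : C) (r : R) (f : C -> C) :
  (forall w, Cmod (w - z0)%C < r ->
     @is_pseries C_AbsRing C_NormedModule a (w - z0)%C (f w)) ->
  forall w, Cmod (w - z0)%C < r ->
    exists l, @is_pseries C_AbsRing C_NormedModule (Cps_derive a) (w - z0)%C l /\
      @is_derive C_AbsRing C_NormedModule f w l.
Proof.
  intros Hf w Hw.
  set (x := (w - z0)%C) in *.
  set (rho := (Cmod x + r) / 2).
  assert (Hx0 := Cmod_ge_0 x).
  assert (Hrho : Cmod x < rho < r) by (unfold rho; lra).
  set (A := fun n => Cmod (a n)).
  assert (HR : Rbar_lt (Rabs rho) (CV_radius A)).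
  (* The series converges at the point z0 + [rho'], so its radius is at least [rho'], strictly
     beyond [rho]. *)
  { set (rho' := (rho + r) / 2).
    assert (Hp : rho < rho' < r) by (unfold rho'; lra).
    apply Rbar_lt_le_trans with (Finite rho').
    - rewrite Rabs_pos_eq by lra; simpl; lra.
    - generalize (CV_radius_Cmod_ge a (RtoC rho') (f (z0 + RtoC rho')%C)).
      rewrite Cmod_R, Rabs_pos_eq by lra; intros HH; apply HH.
      replace (RtoC rho') with (z0 + RtoC rho' - z0)%C by ring.
      replace (z0 + (z0 + RtoC rho' - z0))%C with (z0 + RtoC rho')%C by ring.
      apply Hf.
      replace (z0 + RtoC rho' - z0)%C with (RtoC rho') by ring.
      rewrite Cmod_R, Rabs_pos_eq; lra. }
  assert (Hex : ex_series (K := C_AbsRing) (V := C_CompleteNormedModule)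
                  (fun n => x ^ n * Cps_derive a n)%C).
  { apply (ex_series_le _ (fun n => Rabs (PS_derive A n * rho ^ n))).
    - intros n; change (norm _) with (Cmod (x ^ n * Cps_derive a n)).
      unfold Cps_derive, PS_derive, A.
      rewrite !Cmod_mult, Cmod_pow, Cmod_R, !Rabs_mult, (Rabs_pos_eq (Cmod _)) by apply Cmod_ge_0.
      rewrite (Rabs_pos_eq (rho ^ n)) by (apply pow_le; lra).
      rewrite Rmult_comm; apply Rmult_le_compat_l.
      + apply Rmult_le_pos; [apply Rabs_pos|apply Cmod_ge_0].
      + apply pow_incr; lra.
    - apply CV_disk_inside; rewrite CV_radius_derive; exact HR. }
  destruct Hex as [l Hl].
  exists l; split; [apply is_pseries_C_iff; exact Hl|].
  assert (HM : ex_series (fun n => INR n * INR (S n) * A (S n) * rho ^ pred n)).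
  { apply ex_series_incr_1.
    apply ex_series_ext with (fun n => Rabs (PS_derive (PS_derive A) n * rho ^ n)).
    - intros n; unfold PS_derive, A; simpl pred; refine (_ : @eq R _ _).
      rewrite Rabs_pos_eq; [ring|].
      repeat apply Rmult_le_pos; try apply pos_INR; [apply Cmod_ge_0|apply pow_le; lra].
    - apply CV_disk_inside; rewrite !CV_radius_derive; exact HR. }
  destruct HM as [M HM].
  apply is_derive_C_iff; intros eps Heps.
  (* The first bound keeps x + h in the disc of radius [rho]; the second makes M |h| at most eps,
     the added 1 guarding against M = 0. *)
  exists (Rmin (rho - Cmod x) (eps / (Rabs M + 1))); split.
  { apply Rmin_pos; [lra|apply Rdiv_lt_0_compat; [|generalize (Rabs_pos M)]; lra]. }
  intros v Hv; set (h := (v - w)%C) in *.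
  assert (Hh1 : Cmod h < rho - Cmod x) by (eapply Rlt_le_trans; [exact Hv|apply Rmin_l]).
  assert (Hh2 : Cmod h < eps / (Rabs M + 1)) by (eapply Rlt_le_trans; [exact Hv|apply Rmin_r]).
  assert (Hxh : Cmod (x + h) <= rho) by (eapply Rle_trans; [apply Cmod_triangle|lra]).
  assert (Hvx : (v - z0)%C = (x + h)%C) by (unfold x, h; ring).
  assert (S1 := Hf w Hw); fold x in S1.
  assert (S2 : @is_pseries C_AbsRing C_NormedModule a (v - z0)%C (f v)).
  { apply Hf; rewrite Hvx; lra. }
  rewrite Hvx in S2.
  assert (S3 := is_series_minus _ _ _ _ (proj1 (is_pseries_C_iff _ _ _) S2) (proj1 (is_pseries_C_iff _ _ _) S1)).
  (* The constant terms cancel, so the series can start at index 1 and line up with [Cps_derive]. *)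
  assert (S4 : @is_series C_AbsRing C_NormedModule
                 (fun n => (x + h) ^ S n * a (S n) - x ^ S n * a (S n))%C (f v - f w)%C).
  { apply (is_series_incr_1 (V := C_NormedModule) (fun n => (x + h) ^ n * a n - x ^ n * a n)%C).
    refine (eq_ind _ (is_series _) S3 _ _).
    change ((f v - f w)%C = (f v - f w + ((x + h) ^ 0 * a 0%nat - x ^ 0 * a 0%nat))%C).
    simpl; ring. }
  assert (S5 := is_series_minus _ _ _ _ S4 (is_series_scal h _ _ Hl)).
  apply Rle_trans with (M * Cmod h ^ 2).
  - refine (Cmod_series_le _ (fun n => INR n * INR (S n) * A (S n) * rho ^ pred n * Cmod h ^ 2) _ _ S5 _ _).
    + intros n.
      change (Cmod ((x + h) ^ S n * a (S n) - x ^ S n * a (S n)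
                - h * (x ^ n * (RtoC (INR (S n)) * a (S n))))%C
              <= INR n * INR (S n) * A (S n) * rho ^ pred n * Cmod h ^ 2).
      replace ((x + h) ^ S n * a (S n) - x ^ S n * a (S n)
                - h * (x ^ n * (RtoC (INR (S n)) * a (S n))))%C
        with (a (S n) * ((x + h) ^ S n - x ^ S n - RtoC (INR (S n)) * x ^ n * h))%C by ring.
      rewrite Cmod_mult; unfold A.
      replace (INR n * INR (S n) * Cmod (a (S n)) * rho ^ pred n * Cmod h ^ 2)
        with (Cmod (a (S n)) * (INR n * INR (S n) * rho ^ pred n * Cmod h ^ 2)) by ring.
      apply Rmult_le_compat_l; [apply Cmod_ge_0|].
      apply Cpow_taylor2_le; lra.
    + apply (is_series_scal_r (Cmod h ^ 2) _ _ HM).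
  - assert (Hh0 := Cmod_ge_0 h).
    apply Rle_trans with (Rabs M * Cmod h * Cmod h).
    { generalize (Rmult_le_compat_r _ _ _ (pow_le _ 2 Hh0) (Rle_abs M)); lra. }
    apply Rmult_le_compat_r; [assumption|].
    assert (HM0 := Rabs_pos M).
    apply Rle_trans with ((Rabs M + 1) * (eps / (Rabs M + 1))).
    + apply Rmult_le_compat; lra.
    + right; field; lra.
Qed.

(** * Closure properties of analytic functions *)

Lemma analytic_at_derive (f : C -> C) (z : C) :
  analytic_at f z ->
  @is_derive C_AbsRing C_NormedModule f z (C_derive f z) /\ analytic_at (C_derive f) z.
Proof.
  intros [a [r [Hr Hf]]]; assert (D := Cpseries_derive a z r f Hf).
  split.
  - destruct (D z) as [l [_ Hl]].
    + replace (z - z)%C with (RtoC 0) by ring; rewrite Cmod_0; exact Hr.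
    + rewrite (is_C_derive_unique _ _ _ Hl); exact Hl.
  - exists (Cps_derive a), r; split; [exact Hr|].
    intros w Hw; destruct (D w Hw) as [l [Hl1 Hl2]].
    rewrite (is_C_derive_unique _ _ _ Hl2); exact Hl1.
Qed.

Lemma analytic_at_plus (f g : C -> C) (z : C) :
  analytic_at f z -> analytic_at g z -> analytic_at (fun w => f w + g w)%C z.
Proof.
  intros [a [r [Hr Hf]]] [b [s [Hs Hg]]].
  exists (fun n => a n + b n)%C, (Rmin r s); split; [apply Rmin_pos; assumption|].
  intros w Hw; apply (is_pseries_plus (V := C_NormedModule)).
  - apply Hf; eapply Rlt_le_trans; [exact Hw|apply Rmin_l].
  - apply Hg; eapply Rlt_le_trans; [exact Hw|apply Rmin_r].
Qed.

Lemma analytic_at_mult_id (f : C -> C) (z : C) :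
  analytic_at f z -> analytic_at (fun w => w * f w)%C z.
Proof.
  intros [a [r [Hr Hf]]].
  eexists _, r; split; [exact Hr|]; intros w Hw.
  (* Expanding the factor w about the centre z leaves a scaled series plus a shifted one. *)
  replace (w * f w)%C with (z * f w + (w - z) * f w)%C by ring.
  refine (is_pseries_plus (V := C_NormedModule) _ _ _ _ _ _ _).
  - refine (is_pseries_scal (V := C_NormedModule) z _ _ _ _ (Hf w Hw)); apply Cmult_comm.
  - exact (is_pseries_incr_1 _ _ _ (Hf w Hw)).
Qed.

Lemma analytic_at_const (c z : C) : analytic_at (fun _ => c) z.
Proof.
  exists (fun n => match n with O => c | S _ => RtoC 0 end), 1; split; [lra|].
  intros w _; apply is_pseries_C_iff.
  apply (is_series_decr_1 (V := C_NormedModule)).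
  apply (filterlim_ext (fun _ : nat => RtoC 0)).
  - intros n; induction n; [rewrite sum_O|rewrite sum_Sn, <- IHn];
      change plus with Cplus; ring.
  - refine (eq_ind _ (fun l => filterlim _ _ (locally l)) (filterlim_const (RtoC 0)) _ _).
    change (RtoC 0 = (c + - ((w - z) ^ 0 * c))%C); simpl; ring.
Qed.

(** * Restriction to real lines, and the Laplacian *)

Lemma is_derive_C_line (h : C -> C) (z e l : C) (t : R) :
  @is_derive C_AbsRing C_NormedModule h (z + RtoC t * e)%C l ->
  is_derive (fun s => Re (h (z + RtoC s * e))%C) t (Re (e * l)%C) /\
  is_derive (fun s => Im (h (z + RtoC s * e))%C) t (Im (e * l)%C).
Proof.
  intros H; rewrite is_derive_C_iff in H.
  assert (He := Cmod_ge_0 e).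
  assert (K : forall eps : posreal, exists d : posreal, forall s, Rabs (s - t) < d ->
    Cmod (h (z + RtoC s * e) - h (z + RtoC t * e) - RtoC (s - t) * (e * l))%C
      <= eps * Rabs (s - t)).
  { intros eps.
    assert (Hq : 0 < eps / (Cmod e + 1)) by (apply Rdiv_lt_0_compat; [apply cond_pos|lra]).
    destruct (H _ Hq) as [d [Hd HH]].
    assert (Hd' : 0 < d / (Cmod e + 1)) by (apply Rdiv_lt_0_compat; lra).
    exists (mkposreal _ Hd'); simpl; intros s Hs.
    specialize (HH (z + RtoC s * e)%C).
    replace (z + RtoC s * e - (z + RtoC t * e))%C with (RtoC (s - t) * e)%C in HH
      by (rewrite RtoC_minus; ring).
    rewrite Cmod_mult, Cmod_R in HH.
    assert (Ha := Rabs_pos (s - t)).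
    replace (RtoC (s - t) * (e * l))%C with (RtoC (s - t) * e * l)%C by ring.
    eapply Rle_trans; [apply HH|].
    - apply Rle_lt_trans with (Rabs (s - t) * (Cmod e + 1)).
      + apply Rmult_le_compat_l; lra.
      + apply Rmult_lt_reg_r with (/ (Cmod e + 1)); [apply Rinv_0_lt_compat; lra|].
        replace (Rabs (s - t) * (Cmod e + 1) * / (Cmod e + 1)) with (Rabs (s - t)) by (field; lra).
        exact Hs.
    - replace (eps * Rabs (s - t)) with (eps / (Cmod e + 1) * (Rabs (s - t) * (Cmod e + 1)))
        by (field; lra).
      apply Rmult_le_compat_l; [lra|]; apply Rmult_le_compat_l; lra. }
  (* Re and Im are treated at once as real-linear functionals bounded by the modulus. *)
  assert (Gen : forall (g : C -> R), (forall x y, g (x + y)%C = g x + g y) ->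
     (forall x, g (- x)%C = - g x) -> (forall (r : R) x, g (RtoC r * x)%C = r * g x) ->
     (forall x, Rabs (g x) <= Cmod x) ->
     is_derive (fun s => g (h (z + RtoC s * e))%C) t (g (e * l)%C)).
  { intros g gp go gs gm; split; [apply is_linear_scal_l|].
    intros x Hx.
    assert (E : t = x) by exact (@is_filter_lim_locally_unique _ R_NormedModule t x Hx).
    subst x; intros eps; destruct (K eps) as [d Hd]; exists d; intros s Hs.
    apply Rle_trans with (2 := Hd s Hs).
    eapply Rle_trans; [|apply gm].
    apply Req_le; unfold Cminus; rewrite !gp, !go, gs.
    unfold norm, minus, plus, opp, scal; simpl; unfold abs, mult; simpl; f_equal; ring. }
  split; apply Gen.
  - apply re_plus. - apply re_opp. - apply re_scal_l. - apply re_le_Cmod.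
  - apply im_plus. - apply im_opp. - apply im_scal_l.
  - intros x; eapply Rle_trans; [|apply Rmax_Cmod]; apply Rmax_r.
Qed.

(** At a maximum [L1] vanishes. If l were positive, [L1] would be positive just to the right of 0,
    and by the mean value theorem L would rise above L 0. *)
Lemma derive2_local_max (L L1 : R -> R) (l : R) :
  locally 0 (fun t => is_derive L t (L1 t)) -> is_derive L1 0 l ->
  locally 0 (fun t => L t <= L 0) -> l <= 0.
Proof.
  intros [d1 H1] H2 [d3 H3].
  destruct (Rle_or_lt l 0) as [|Hl]; [assumption|exfalso].
  assert (H0 : L1 0 = 0).
  { assert (D0 : is_derive L 0 (L1 0)) by (apply H1, ball_center).
    apply is_derive_Reals in D0.
    assert (pr : derivable_pt L 0) by (exists (L1 0); exact D0).
    rewrite <- (derive_pt_eq_0 L 0 (L1 0) pr D0).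
    apply (deriv_maximum L (- d3) d3); try (generalize (cond_pos d3); lra).
    intros x Hx1 Hx2; apply H3.
    unfold ball; simpl; unfold AbsRing_ball, abs, minus, plus, opp; simpl.
    apply Rabs_def1; lra. }
  apply is_derive_Reals in H2.
  destruct (H2 (l / 2) ltac:(lra)) as [d2 Hd2].
  set (t := Rmin (d1 / 2) (Rmin (d2 / 2) (d3 / 2))).
  assert (Ht : 0 < t /\ t < d1 /\ t < d2 /\ t < d3).
  { generalize (cond_pos d1) (cond_pos d2) (cond_pos d3); intros P1 P2 P3.
    unfold t, Rmin; repeat destruct Rle_dec; lra. }
  destruct Ht as [Ht [Ht1 [Ht2 Ht3]]].
  destruct (MVT_cor2 L L1 0 t Ht) as [c [E Hc]].
  { intros c Hc; apply is_derive_Reals, H1.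
    unfold ball; simpl; unfold AbsRing_ball, abs, minus, plus, opp; simpl.
    apply Rabs_def1; lra. }
  assert (HL : L t <= L 0).
  { apply H3; unfold ball; simpl; unfold AbsRing_ball, abs, minus, plus, opp; simpl.
    apply Rabs_def1; lra. }
  assert (Hc2 : Rabs ((L1 (0 + c) - L1 0) / c - l) < l / 2).
  { apply Hd2; [lra|apply Rabs_def1; lra]. }
  rewrite H0, Rplus_0_l, Rminus_0_r in Hc2; apply Rabs_def2 in Hc2.
  assert (Hpos : 0 < L1 c).
  { replace (L1 c) with (L1 c / c * c) by (field; lra).
    apply Rmult_lt_0_compat; lra. }
  generalize (Rmult_lt_0_compat _ _ Hpos Ht); rewrite Rminus_0_r in E; lra.
Qed.

(** The witness g is the first derivative on a whole neighbourhood of 0, so the relation asserts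
    existence of the second derivative along e as well as its value. *)
Definition directional2 (F : C -> R) (z e : C) (l : R) : Prop :=
  exists g : R -> R,
    locally 0 (fun t => is_derive (fun s => F (z + RtoC s * e)%C) t (g t)) /\
    is_derive g 0 l.

Definition has_laplacian (F : C -> R) (z : C) (l : R) : Prop :=
  exists lx ly, directional2 F z (RtoC 1) lx /\ directional2 F z Ci ly /\ l = lx + ly.

Lemma directional2_lin (F G : C -> R) (z e : C) (a b l m : R) :
  directional2 F z e l -> directional2 G z e m ->
  directional2 (fun w => a * F w + b * G w) z e (a * l + b * m).
Proof.
  intros [f [Hf1 Hf2]] [g [Hg1 Hg2]].
  assert (K : forall (u v : R -> R) (x du dv : R), is_derive u x du -> is_derive v x dv ->
     is_derive (fun t => a * u t + b * v t) x (a * du + b * dv)).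
  { intros u v x du dv Hu Hv.
    exact (is_derive_plus _ _ _ _ _ (is_derive_scal _ _ a _ Hu) (is_derive_scal _ _ b _ Hv)). }
  exists (fun t => a * f t + b * g t); split.
  - generalize (filter_and _ _ Hf1 Hg1); apply filter_imp; intros t [H1 H2].
    apply K; assumption.
  - apply K; assumption.
Qed.

Lemma has_laplacian_lin (F G : C -> R) (z : C) (a b l m : R) :
  has_laplacian F z l -> has_laplacian G z m ->
  has_laplacian (fun w => a * F w + b * G w) z (a * l + b * m).
Proof.
  intros [lx [ly [Hx [Hy ->]]]] [mx [my [Gx [Gy ->]]]].
  exists (a * lx + b * mx), (a * ly + b * my).
  split; [|split; [|ring]]; apply directional2_lin; assumption.
Qed.

Lemma has_laplacian_local_max (F : C -> R) (z : C) (l d : R) :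
  has_laplacian F z l -> 0 < d ->
  (forall w, Cmod (w - z)%C < d -> F w <= F z) -> l <= 0.
Proof.
  intros [lx [ly [Hx [Hy ->]]]] Hd Hmax.
  assert (K : forall e m, Cmod e = 1 -> directional2 F z e m -> m <= 0).
  { intros e m He [g [H1 H2]].
    apply (derive2_local_max _ _ _ H1 H2).
    exists (mkposreal d Hd); intros t Ht.
    replace (z + RtoC 0 * e)%C with z by ring.
    apply Hmax; replace (z + RtoC t * e - z)%C with (RtoC t * e)%C by ring.
    rewrite Cmod_mult, Cmod_R, He, Rmult_1_r.
    replace t with (t - 0) by ring; exact Ht. }
  assert (lx <= 0) by (apply (K (RtoC 1)); [apply Cmod_1|assumption]).
  assert (ly <= 0) by (apply (K Ci); [apply Cmod_Ci|assumption]).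
  lra.
Qed.

(** This is the source of strict positivity in the maximum principle. *)
Lemma has_laplacian_sqr_Cmod (z : C) : has_laplacian (fun w => Cmod w ^ 2) z 4.
Proof.
  exists 2, 2; split; [|split; [|ring]].
  - exists (fun t => 2 * (fst z + t)); split.
    + apply filter_forall; intros t.
      apply is_derive_ext with (fun s => (fst z + s) ^ 2 + snd z ^ 2).
      { intros s; rewrite Cmod2_alt; simpl; unfold Re, Im; simpl; ring. }
      auto_derive; [trivial|ring].
    + auto_derive; [trivial|ring].
  - exists (fun t => 2 * (snd z + t)); split.
    + apply filter_forall; intros t.
      apply is_derive_ext with (fun s => fst z ^ 2 + (snd z + s) ^ 2).
      { intros s; rewrite Cmod2_alt; simpl; unfold Re, Im; simpl; ring. }
      auto_derive; [trivial|ring].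
    + auto_derive; [trivial|ring].
Qed.

(** Along the line N = u^2 + v^2, and (ln N)'' = N''/N - (N'/N)^2. The successive derivatives of h
    along the line are e h' and e^2 h''. *)
Lemma directional2_ln_sqr_Cmod (h : C -> C) (z e : C) :
  locally 0 (fun t => analytic_at h (z + RtoC t * e)%C) -> h z <> RtoC 0 ->
  let u := Re (h z) in let v := Im (h z) in
  let u1 := Re (e * C_derive h z)%C in let v1 := Im (e * C_derive h z)%C in
  let u2 := Re (e * (e * C_derive (C_derive h) z))%C in
  let v2 := Im (e * (e * C_derive (C_derive h) z))%C in
  let N := u ^ 2 + v ^ 2 in
  directional2 (fun w => ln (Cmod (h w) ^ 2)) z e
    (2 * (u1 ^ 2 + u * u2 + v1 ^ 2 + v * v2) / N - (2 * (u * u1 + v * v1) / N) ^ 2).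
Proof.
  intros Ha Hz u v u1 v1 u2 v2 N.
  set (a := fun t : R => Re (h (z + RtoC t * e))%C).
  set (b := fun t : R => Im (h (z + RtoC t * e))%C).
  set (a1 := fun t : R => Re (e * C_derive h (z + RtoC t * e))%C).
  set (b1 := fun t : R => Im (e * C_derive h (z + RtoC t * e))%C).
  assert (E0 : (z + RtoC 0 * e)%C = z) by ring.
  assert (Hder : locally 0 (fun t => is_derive a t (a1 t) /\ is_derive b t (b1 t))).
  { revert Ha; apply filter_imp; intros t Ht.
    apply is_derive_C_line, analytic_at_derive, Ht. }
  assert (Hder2 : is_derive a1 0 u2 /\ is_derive b1 0 v2).
  { assert (H0 : analytic_at h z).
    { rewrite <- E0; exact (locally_singleton _ _ Ha). }
    destruct (analytic_at_derive _ _ H0) as [_ H1].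
    destruct (analytic_at_derive _ _ H1) as [H2 _].
    rewrite <- E0 in H2 at 1; apply is_derive_C_line in H2; destruct H2 as [H2 H3].
    split.
    - apply is_derive_ext with (fun t => Re e * Re (C_derive h (z + RtoC t * e))%C
        - Im e * Im (C_derive h (z + RtoC t * e))%C).
      { intros t; unfold a1; rewrite re_mult; reflexivity. }
      unfold u2; rewrite re_mult.
      apply (is_derive_minus (V := R_NormedModule)); apply is_derive_scal; assumption.
    - apply is_derive_ext with (fun t => Re e * Im (C_derive h (z + RtoC t * e))%C
        + Im e * Re (C_derive h (z + RtoC t * e))%C).
      { intros t; unfold b1; rewrite im_mult; reflexivity. }
      unfold v2; rewrite im_mult.
      apply (is_derive_plus (V := R_NormedModule)); apply is_derive_scal; assumption. }
  assert (HN : forall w, h w <> RtoC 0 -> 0 < Cmod (h w) ^ 2).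
  { intros w Hw; apply pow_lt, Cmod_gt_0, Hw. }
  destruct (locally_singleton _ _ Hder) as [Da Db]; destruct Hder2 as [Da1 Db1].
  assert (Ea : a 0 = u) by (unfold a; rewrite E0; reflexivity).
  assert (Eb : b 0 = v) by (unfold b; rewrite E0; reflexivity).
  assert (Ea1 : a1 0 = u1) by (unfold a1; rewrite E0; reflexivity).
  assert (Eb1 : b1 0 = v1) by (unfold b1; rewrite E0; reflexivity).
  assert (HN0 : 0 < N) by (unfold N, u, v; rewrite <- Cmod2_alt; apply HN, Hz).
  (* The first derivative of the logarithm is needed near 0, so h must stay nonzero on a
     neighbourhood. *)
  assert (Hpos : locally 0 (fun t => 0 < a t ^ 2 + b t ^ 2)).
  { assert (Hc : continuous (fun t => a t ^ 2 + b t ^ 2) 0).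
    { apply (ex_derive_continuous (V := R_NormedModule)).
      auto_derive; repeat split; [exists (a1 0)|exists (b1 0)]; assumption. }
    apply (Hc (fun y => 0 < y)).
    rewrite Ea, Eb; apply open_gt; exact HN0. }
  exists (fun t => 2 * (a t * a1 t + b t * b1 t) / (a t ^ 2 + b t ^ 2)); split.
  - generalize (filter_and _ _ Hder Hpos); apply filter_imp; intros t [[H1 H2] H3].
    apply is_derive_ext with (fun s => ln (a s ^ 2 + b s ^ 2)).
    { intros s; unfold a, b; rewrite Cmod2_alt; reflexivity. }
    auto_derive.
    + repeat split; [exists (a1 t)|exists (b1 t)|]; trivial.
    + rewrite (is_derive_unique (fun x : R => a x) _ _ H1), (is_derive_unique (fun x : R => b x) _ _ H2); field; lra.
  - auto_derive.
    + repeat split; try (eexists; eassumption). rewrite Ea, Eb; exact (Rgt_not_eq _ _ HN0).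
    + rewrite (is_derive_unique (fun x : R => a x) _ _ Da), (is_derive_unique (fun x : R => b x) _ _ Db),
        (is_derive_unique (fun x : R => a1 x) _ _ Da1), (is_derive_unique (fun x : R => b1 x) _ _ Db1), Ea, Eb, Ea1, Eb1.
      unfold N in *; field; lra.
Qed.

(** In the sum over e = 1 and e = i the h'' terms cancel because 1 + i^2 = 0. What remains is 4
    |h'|^2 / N - 4 |h|^2 |h'|^2 / N^2, which is 0 since N = |h|^2; the Cauchy-Riemann equations are
    implicit in the products e h'. *)
Lemma has_laplacian_ln_sqr_Cmod (h : C -> C) (z : C) (d : R) :
  0 < d -> (forall w, Cmod (w - z)%C < d -> analytic_at h w) -> h z <> RtoC 0 ->
  has_laplacian (fun w => ln (Cmod (h w) ^ 2)) z 0.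
Proof.
  intros Hd Ha Hz.
  assert (K : forall e, Cmod e = 1 -> locally 0 (fun t => analytic_at h (z + RtoC t * e)%C)).
  { intros e He; exists (mkposreal d Hd); intros t Ht; apply Ha.
    replace (z + RtoC t * e - z)%C with (RtoC t * e)%C by ring.
    rewrite Cmod_mult, Cmod_R, He, Rmult_1_r.
    replace t with (t - 0) by ring; exact Ht. }
  assert (HN : 0 < Cmod (h z) ^ 2) by (apply pow_lt, Cmod_gt_0, Hz).
  rewrite Cmod2_alt in HN.
  eexists _, _; split; [|split].
  - apply directional2_ln_sqr_Cmod; [apply K, Cmod_1|exact Hz].
  - apply directional2_ln_sqr_Cmod; [apply K, Cmod_Ci|exact Hz].
  - rewrite !re_mult, !im_mult, !re_mult; simpl (Re (RtoC 1)); simpl (Im (RtoC 1));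
      simpl (Re Ci); simpl (Im Ci).
    field; lra.
Qed.

(** * Maxima of upper semicontinuous functions on a closed disc *)

Lemma sqrt_2_le_2 : sqrt 2 <= 2.
Proof.
  rewrite <- (sqrt_Rsqr 2) at 2 by lra.
  apply sqrt_le_1_alt; unfold Rsqr; lra.
Qed.

(** If no maximum existed, every point of the disc would have a neighbourhood on which F lies below
    one of its own values. Finitely many neighbourhoods cover the disc, and the point realising the
    largest of these values lies in one of them, a contradiction. *)
Lemma usc_attains_max_on_disc (F : C -> R) (rho : R) :
  0 <= rho ->
  (forall z, Cmod z <= rho -> forall c, F z < c -> exists d, 0 < d /\
     forall w, Cmod w <= rho -> Cmod (w - z)%C < d -> F w < c) ->
  exists z0, Cmod z0 <= rho /\ forall w, Cmod w <= rho -> F w <= F z0.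
Proof.
  intros Hrho Husc.
  destruct (classic (exists z0, Cmod z0 <= rho /\ forall w, Cmod w <= rho -> F w <= F z0))
    as [|Hno]; [assumption|exfalso].
  (* The compactness lemma works on a square with sup-norm balls. Doubling the radius absorbs the
     factor sqrt 2 between the modulus and the sup norm. *)
  assert (K : forall t : C, exists q : posreal * C, Cmod (snd q) <= rho /\
     forall w, Cmod w <= rho -> Cmod (w - t)%C < 2 * fst q -> F w < F (snd q)).
  { intros t; destruct (Rle_or_lt (Cmod t) rho) as [Ht|Ht].
    - assert (exists z', Cmod z' <= rho /\ F t < F z') as [z' [Hz1 Hz2]].
      { apply NNPP; intros Hn; apply Hno; exists t; split; [exact Ht|].
        intros w Hw; apply Rnot_lt_le; intros Hlt; apply Hn; exists w; auto. }
      destruct (Husc t Ht _ Hz2) as [d [Hd Hd2]].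
      exists (mkposreal (d / 2) ltac:(lra), z'); simpl; split; [exact Hz1|].
      intros w Hw1 Hw2; apply Hd2; [exact Hw1|lra].
    - exists (mkposreal ((Cmod t - rho) / 2) ltac:(lra), RtoC 0); simpl; split.
      (* For t outside the disc the point 0 is a dummy: the neighbourhood chosen for t misses the
         disc. *)
      { rewrite Cmod_0; exact Hrho. }
      intros w Hw1 Hw2; exfalso.
      assert (Cmod t <= Cmod w + Cmod (w - t)%C).
      { rewrite <- (Cmod_opp (w - t)%C); replace t with (w + - (w - t))%C at 1 by ring.
        apply Cmod_triangle. }
      lra. }
  set (q := fun t : C => proj1_sig (constructive_indefinite_description _ (K t))).
  assert (Hq : forall t : C, Cmod (snd (q t)) <= rho /\
     forall w, Cmod w <= rho -> Cmod (w - t)%C < 2 * fst (q t) -> F w < F (snd (q t)))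
    by (intros t; exact (proj2_sig (constructive_indefinite_description _ (K t)))).
  set (pt := fun x : Compactness.Tn 2 R => (fst x, fst (snd x)) : C).
  apply (compactness_list 2 (- rho, (- rho, tt)) (rho, (rho, tt)) (fun x => fst (q (pt x)))).
  intros [l Hl].
  assert (Hmax : forall l' : list (Compactness.Tn 2 R), exists z', Cmod z' <= rho /\
     forall t, In t l' -> F (snd (q (pt t))) <= F z').
  { induction l' as [|t l' [z' [IH1 IH2]]].
    - exists (RtoC 0); rewrite Cmod_0; split; [exact Hrho|intros t []].
    - destruct (Rle_or_lt (F (snd (q (pt t)))) (F z')) as [Hle|Hlt].
      + exists z'; split; [exact IH1|]; intros s [<-|Hs]; auto.
      + exists (snd (q (pt t))); split; [apply Hq|].
        intros s [<-|Hs]; [lra|]; specialize (IH2 s Hs); lra. }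
  destruct (Hmax l) as [z' [Hz1 Hz2]].
  assert (Hb : Rmax (Rabs (fst z')) (Rabs (snd z')) <= rho)
    by (eapply Rle_trans; [apply Rmax_Cmod|exact Hz1]).
  assert (Hb1 : Rabs (fst z') <= rho) by (eapply Rle_trans; [apply Rmax_l|exact Hb]).
  assert (Hb2 : Rabs (snd z') <= rho) by (eapply Rle_trans; [apply Rmax_r|exact Hb]).
  apply Rabs_le_between in Hb1; apply Rabs_le_between in Hb2.
  destruct (Hl (fst z', (snd z', tt))) as [[t1 [t2 []]] [Ht1 [_ Ht2]]].
  { simpl; tauto. }
  specialize (Hz2 _ Ht1); unfold pt in *; simpl in Hz2, Ht2.
  destruct Ht2 as [Hc1 [Hc2 _]].
  destruct (Hq (t1, t2)) as [_ Hq2].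
  assert (Hcl : Cmod (z' - (t1, t2))%C < 2 * fst (q (t1, t2))).
  { eapply Rle_lt_trans; [apply Cmod_2Rmax|].
    assert (Hm : Rmax (Rabs (fst (z' - (t1, t2))%C)) (Rabs (snd (z' - (t1, t2))%C))
                 < fst (q (t1, t2))) by (apply Rmax_lub_lt; assumption).
    apply Rle_lt_trans with (2 * Rmax (Rabs (fst (z' - (t1, t2))%C)) (Rabs (snd (z' - (t1, t2))%C))).
    - apply Rmult_le_compat_r; [|exact sqrt_2_le_2].
      eapply Rle_trans; [apply Rabs_pos|apply Rmax_l].
    - lra. }
  specialize (Hq2 z' Hz1 Hcl); lra.
Qed.

(** * Schwarz's lemma for the right half-plane *)

Lemma exp_le_iff (x y : R) : exp x <= exp y <-> x <= y.
Proof.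
  split; intros [H|H].
  - left; apply exp_lt_inv, H.
  - right; apply exp_inv, H.
  - left; apply exp_increasing, H.
  - right; f_equal; exact H.
Qed.

(** Besides continuity, this gives the linear decay of p - 1 at 0 that beats the singular power of
    |z| in [schwarz_right_half_plane]. *)
Lemma analytic_at_lipschitz (f : C -> C) (z : C) :
  analytic_at f z -> exists K d, 0 < K /\ 0 < d /\
    forall w, Cmod (w - z)%C < d -> Cmod (f w - f z)%C <= K * Cmod (w - z)%C.
Proof.
  intros Hf; destruct (analytic_at_derive _ _ Hf) as [H _].
  rewrite is_derive_C_iff in H; destruct (H 1 Rlt_0_1) as [d [Hd Hw]].
  set (l := C_derive f z) in *.
  exists (1 + Cmod l), d; split; [generalize (Cmod_ge_0 l); lra|split; [exact Hd|]].
  intros w Hwd; specialize (Hw w Hwd).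
  replace (f w - f z)%C with (f w - f z - (w - z) * l + (w - z) * l)%C by ring.
  eapply Rle_trans; [apply Cmod_triangle|].
  rewrite (Cmod_mult (w - z)); lra.
Qed.

Lemma analytic_at_continuous_Cmod (f : C -> C) (z : C) :
  analytic_at f z -> continuous (fun w : C_UniformSpace => Cmod (f w)) z.
Proof.
  intros Hf; destruct (analytic_at_lipschitz _ _ Hf) as [K [d [HK [Hd H]]]].
  apply filterlim_locally; intros eps.
  (* Balls of [C_UniformSpace] are squares; halving the radius absorbs the factor sqrt 2. *)
  assert (Hr : 0 < Rmin d (eps / K) / 2).
  { generalize (Rmin_pos d (eps / K) Hd (Rdiv_lt_0_compat _ _ (cond_pos eps) HK)); lra. }
  exists (mkposreal _ Hr); intros w Hw.
  assert (Hwz : Cmod (w - z)%C < Rmin d (eps / K)).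
  { eapply Rlt_le_trans; [exact (C_NormedModule_mixin_compat2 _ _ _ Hw)|]; simpl.
    generalize (Rmult_le_compat_r _ _ _ (Rlt_le _ _ Hr) sqrt_2_le_2); lra. }
  assert (H1 : Cmod (f w - f z)%C < eps).
  { apply Rle_lt_trans with (K * Cmod (w - z)%C).
    - apply H; eapply Rlt_le_trans; [exact Hwz|apply Rmin_l].
    - apply Rlt_le_trans with (K * (eps / K)); [|right; field; lra].
      apply Rmult_lt_compat_l; [exact HK|].
      eapply Rlt_le_trans; [exact Hwz|apply Rmin_r]. }
  apply Rle_lt_trans with (2 := H1).
  exact (@norm_triangle_inv C_AbsRing C_NormedModule (f w) (f z)).
Qed.

Lemma locally_C_Cmod (z : C) (P : C -> Prop) :
  locally (T := C_UniformSpace) z P ->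
  exists d, 0 < d /\ forall w, Cmod (w - z)%C < d -> P w.
Proof.
  intros [d Hd]; exists d; split; [apply cond_pos|].
  intros w Hw; apply Hd, C_NormedModule_mixin_compat1, Hw.
Qed.

(** The squares differ by 4 Re p. *)
Lemma Cmod_minus_1_lt_plus_1 (p : C) : 0 < Re p -> Cmod (p - 1)%C < Cmod (p + 1)%C.
Proof.
  intros Hp; apply Rsqr_incrst_0; try apply Cmod_ge_0.
  rewrite !Rsqr_pow2, !Cmod2_alt; unfold Cminus.
  rewrite !re_plus, !im_plus, re_opp, im_opp, re_RtoC, im_RtoC; nra.
Qed.

Lemma schwarz_right_half_plane (p : C -> C) :
  analytic_on unit_disc p -> p (RtoC 0) = RtoC 1 ->
  (forall z, unit_disc z -> 0 < Re (p z)) ->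
  forall z, unit_disc z -> Cmod (p z - 1)%C <= Cmod z * Cmod (p z + 1)%C.
Proof.
  intros Hp Hp0 Hpos z1 Hz1.
  apply Rnot_lt_le; intros Hlt.
  assert (Hm1 : forall z, unit_disc z -> analytic_at (fun w => p w + (- (1)))%C z).
  { intros z Hz; apply analytic_at_plus; [apply Hp, Hz|apply analytic_at_const]. }
  assert (Hp1 : forall z, unit_disc z -> analytic_at (fun w => p w + 1)%C z).
  { intros z Hz; apply analytic_at_plus; [apply Hp, Hz|apply analytic_at_const]. }
  assert (Hid : forall z, analytic_at (fun w => w * 1)%C z).
  { intros z; apply (analytic_at_mult_id (fun _ => RtoC 1)), analytic_at_const. }
  assert (Hge1 : forall z, unit_disc z -> 1 <= Cmod (p z + 1)%C).
  { intros z Hz; eapply Rle_trans; [|eapply Rle_trans; [apply Rle_abs|apply re_le_Cmod]].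
    rewrite re_plus, re_RtoC; specialize (Hpos z Hz); lra. }
  set (phi2 := fun z => Cmod (p z + - (1))%C ^ 2 / Cmod (p z + 1)%C ^ 2).
  assert (Hphi0 : forall z, unit_disc z -> 0 <= phi2 z < 1).
  { intros z Hz; unfold phi2.
    assert (H0 := Cmod_ge_0 (p z + - (1))%C).
    assert (H1 := Hge1 z Hz).
    assert (H2 := Cmod_minus_1_lt_plus_1 (p z) (Hpos z Hz)); unfold Cminus in H2.
    split.
    - apply Rdiv_le_0_compat; [apply pow_le, H0|apply pow_lt; lra].
    - apply Rmult_lt_reg_r with (Cmod (p z + 1)%C ^ 2); [apply pow_lt; lra|].
      unfold Rdiv; rewrite Rmult_assoc, Rinv_l, Rmult_1_r, Rmult_1_l by (apply pow_nonzero; lra).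
      nra. }
  assert (Hz1n : 0 < Cmod z1).
  { destruct (Cmod_ge_0 z1) as [|E]; [assumption|].
    symmetry in E; apply Cmod_eq_0 in E; subst z1; rewrite Hp0 in Hlt.
    replace (1 - 1)%C with (RtoC 0) in Hlt by ring; rewrite Cmod_0 in Hlt; lra. }
  unfold unit_disc in Hz1.
  (* If the bound failed at [z1], the function [F] below, a power of [Cmod z] with
     exponent [- 2 beta] close to [- 2] times a strictly log-subharmonic factor, would
     still exceed its values on the circle [Cmod z = rho]; at [0] it tends to [0]
     since [beta < 1], so no removable singularity has to be treated. *)
  set (Lam := - ln (Cmod z1 ^ 2)).
  assert (HLam : 0 < Lam).
  { unfold Lam; apply Ropp_0_gt_lt_contravar.
    apply Rlt_le_trans with (ln 1); [|rewrite ln_1; lra].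
    apply ln_increasing; [apply pow_lt; exact Hz1n|nra]. }
  (* [D] is the logarithm of [phi2 z1] / |z1|^2, the amount by which the bound is violated at [z1].
     It is the budget for all perturbations below. *)
  set (D := ln (phi2 z1) + Lam).
  assert (Hq : Cmod z1 ^ 2 < phi2 z1).
  { unfold phi2; specialize (Hge1 z1 Hz1).
    apply Rmult_lt_reg_r with (Cmod (p z1 + 1)%C ^ 2); [apply pow_lt; lra|].
    unfold Rdiv; rewrite Rmult_assoc, Rinv_l, Rmult_1_r by (apply pow_nonzero; lra).
    change (p z1 + - (1))%C with (p z1 - 1)%C.
    rewrite <- Rpow_mult_distr.
    assert (0 <= Cmod z1 * Cmod (p z1 + 1)%C) by (apply Rmult_le_pos; lra).
    nra. }
  assert (Hz12 : 0 < Cmod z1 ^ 2) by (apply pow_lt, Hz1n).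
  assert (HD : 0 < D < Lam).
  { unfold D, Lam; split.
    - generalize (ln_increasing _ _ Hz12 Hq); lra.
    - destruct (Hphi0 z1 Hz1) as [_ Hl].
      assert (ln (phi2 z1) < ln 1) by (apply ln_increasing; lra).
      rewrite ln_1 in H; lra. }
  (* The constants are tuned so that ln [F z1] >= 3D/4, the choice of [beta] costing D/4. On the
     circle ln [rho]^2 = - D/4, so there ln F < D/4 + D/4 = D/2. *)
  set (rho := exp (- D / 8)).
  set (beta := 1 - D / (4 * Lam)).
  assert (Hbeta : 0 < beta < 1).
  { unfold beta; assert (0 < D / (4 * Lam)) by (apply Rdiv_lt_0_compat; lra).
    assert (D / (4 * Lam) < 1) by (apply Rmult_lt_reg_r with (4 * Lam); [lra|];
      unfold Rdiv; rewrite Rmult_assoc, Rinv_l; lra). lra. }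
  assert (Hrho : 0 < rho < 1).
  { unfold rho; split; [apply exp_pos|rewrite <- exp_0; apply exp_increasing; lra]. }
  assert (Hrho2 : ln (rho ^ 2) = - D / 4).
  { unfold rho; simpl; rewrite Rmult_1_r, <- exp_plus, ln_exp; field. }
  set (F := fun z => phi2 z * exp (- beta * ln (Cmod z ^ 2) + D / 4 * Cmod z ^ 2)).
  assert (HF0 : F (RtoC 0) = 0).
  { unfold F, phi2; rewrite Hp0.
    replace (1 + - (1))%C with (RtoC 0) by ring; rewrite Cmod_0; unfold Rdiv; ring. }
  assert (HFc : forall z, unit_disc z -> z <> RtoC 0 ->
            continuous (fun w : C_UniformSpace => F w) z).
  { intros z Hz Hz0.
    assert (Cid : continuous (fun w : C_UniformSpace => Cmod w) z).
    { apply continuous_ext with (2 := analytic_at_continuous_Cmod _ _ (Hid z)).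
      intros w; f_equal; apply Cmult_1_r. }
    assert (C1 := analytic_at_continuous_Cmod _ _ (Hm1 z Hz)).
    assert (C2 := analytic_at_continuous_Cmod _ _ (Hp1 z Hz)).

    unfold F, phi2.
    apply (continuous_mult (fun w : C_UniformSpace => Cmod (p w + - (1))%C ^ 2 / Cmod (p w + 1)%C ^ 2)
             (fun w => exp (- beta * ln (Cmod w ^ 2) + D / 4 * Cmod w ^ 2))).
    - apply (continuous_mult (fun w : C_UniformSpace => Cmod (p w + - (1))%C ^ 2)
               (fun w => / Cmod (p w + 1)%C ^ 2)).
      + apply (continuous_comp (fun w : C_UniformSpace => Cmod (p w + - (1))%C) (fun x => x ^ 2) z C1).
        apply (ex_derive_continuous (V := R_NormedModule)); auto_derive; trivial.
      + apply (continuous_comp (fun w : C_UniformSpace => Cmod (p w + 1)%C) (fun x => / x ^ 2) z C2).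
        apply (ex_derive_continuous (V := R_NormedModule)); auto_derive.
        generalize (Hge1 z Hz); intros; nra.
    - apply (continuous_comp (fun w : C_UniformSpace => Cmod w)
               (fun x => exp (- beta * ln (x ^ 2) + D / 4 * x ^ 2)) z Cid).
      apply (ex_derive_continuous (V := R_NormedModule)); auto_derive.
      apply Cmod_gt_0 in Hz0; nra. }
  destruct (usc_attains_max_on_disc F rho) as [z0 [Hz0 Hmax]].
  { lra. }
  { intros z Hz c Hc.
    destruct (Ceq_dec z (RtoC 0)) as [->|Hn].
    - rewrite HF0 in Hc.
      destruct (analytic_at_lipschitz p (RtoC 0)) as [K [d [HK [Hd HL]]]].
      { apply Hp; unfold unit_disc; rewrite Cmod_0; lra. }
      (* Near 0 the Lipschitz bound gives F w <= K^2 exp(D/4) |w|^(2 (1 - beta)). The radius taken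
         below is the solution of |w|^(2 (1 - beta)) = [c']. *)
      set (c' := c / (K ^ 2 * exp (D / 4))).
      assert (Hke : 0 < K ^ 2 * exp (D / 4)) by (apply Rmult_lt_0_compat; [apply pow_lt, HK|apply exp_pos]).
      assert (Hc' : 0 < c') by (apply Rdiv_lt_0_compat; assumption).
      exists (Rmin d (exp (ln c' / (2 * (1 - beta))))); split.
      { apply Rmin_pos; [exact Hd|apply exp_pos]. }
      intros w Hw1 Hw2.
      replace (w - 0)%C with w in Hw2 by ring.
      destruct (Cmod_ge_0 w) as [Hw0|E].
      2:{ symmetry in E; apply Cmod_eq_0 in E; subst w; rewrite HF0; exact Hc. }
      assert (Hwd : Cmod w < d) by (eapply Rlt_le_trans; [exact Hw2|apply Rmin_l]).
      assert (Hwe : Cmod w < exp (ln c' / (2 * (1 - beta)))) by (eapply Rlt_le_trans; [exact Hw2|apply Rmin_r]).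
      assert (Hwu : unit_disc w) by (unfold unit_disc; lra).
      specialize (HL w); replace (w - 0)%C with w in HL by ring.
      specialize (HL Hwd); rewrite Hp0 in HL; unfold Cminus in HL.
      assert (Hw02 : 0 < Cmod w ^ 2) by (apply pow_lt, Hw0).
      assert (B1 : phi2 w <= K ^ 2 * Cmod w ^ 2).
      { unfold phi2; specialize (Hge1 w Hwu).
        apply Rmult_le_reg_r with (Cmod (p w + 1)%C ^ 2); [apply pow_lt; lra|].
        unfold Rdiv; rewrite Rmult_assoc, Rinv_l, Rmult_1_r by (apply pow_nonzero; lra).
        rewrite <- Rpow_mult_distr.
        assert (Hkw : 0 < K * Cmod w) by (apply Rmult_lt_0_compat; assumption).
        assert (H0 := Cmod_ge_0 (p w + - (1))%C).
        assert (1 <= Cmod (p w + 1)%C ^ 2) by nra.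
        assert (Cmod (p w + - (1))%C ^ 2 <= (K * Cmod w) ^ 2) by (apply pow_incr; lra).
        nra. }
      assert (B2 : exp ((1 - beta) * ln (Cmod w ^ 2)) < c').
      { rewrite <- (exp_ln c' Hc'); apply exp_increasing.
        assert (Hl : ln (Cmod w) < ln c' / (2 * (1 - beta)))
          by (rewrite <- (ln_exp (ln c' / (2 * (1 - beta)))); apply ln_increasing; assumption).
        simpl; rewrite Rmult_1_r, ln_mult by assumption.
        apply (Rmult_lt_compat_l (2 * (1 - beta))) in Hl; [|lra].
        replace (2 * (1 - beta) * (ln c' / (2 * (1 - beta)))) with (ln c') in Hl by (field; lra).
        lra. }
      apply Rle_lt_trans with (K ^ 2 * exp (D / 4) * exp ((1 - beta) * ln (Cmod w ^ 2))).
      + unfold F.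
        apply Rle_trans with (K ^ 2 * Cmod w ^ 2 * exp (- beta * ln (Cmod w ^ 2) + D / 4 * Cmod w ^ 2)).
        { apply Rmult_le_compat_r; [apply Rlt_le, exp_pos|exact B1]. }
        rewrite <- (exp_ln (Cmod w ^ 2)) at 1 by assumption.
        rewrite !Rmult_assoc, <- !exp_plus.
        apply Rmult_le_compat_l; [apply pow2_ge_0|].
        apply exp_le_iff; assert (Cmod w ^ 2 <= 1) by (unfold unit_disc in Hwu; nra); nra.
      + apply (Rmult_lt_compat_l _ _ _ Hke) in B2.
        replace (K ^ 2 * exp (D / 4) * c') with c in B2 by (unfold c'; field; split; [apply Rgt_not_eq, exp_pos|lra]).
        exact B2.
    - assert (Hzu : unit_disc z) by (unfold unit_disc; lra).
      destruct (locally_C_Cmod z (fun w => F w < c)) as [d [Hd H]].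
      { apply (HFc z Hzu Hn (fun y => y < c)), open_lt; exact Hc. }
      exists d; split; [exact Hd|]; intros w _; apply H. }
  assert (HlnLam : 2 * ln (Cmod z1) = - Lam).
  { unfold Lam; simpl; rewrite Rmult_1_r, ln_mult by assumption; ring. }
  assert (Hz1r : Cmod z1 <= rho).
  { rewrite <- (exp_ln (Cmod z1) Hz1n); unfold rho; apply exp_le_iff; lra. }
  assert (HF1 : exp (3 * D / 4) <= F z1).
  { unfold F.
    rewrite <- (exp_ln (phi2 z1)) by lra.
    rewrite <- exp_plus; apply exp_le_iff.
    replace (ln (phi2 z1)) with (D - Lam) by (unfold D; ring).
    replace (ln (Cmod z1 ^ 2)) with (- Lam) by (unfold Lam; ring).
    replace (- beta * - Lam) with (Lam - D / 4) by (unfold beta; field; lra).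
    assert (0 <= D / 4 * Cmod z1 ^ 2) by (apply Rmult_le_pos; lra).
    lra. }
  assert (HF01 := Hmax z1 Hz1r).
  assert (He0 := exp_pos (3 * D / 4)).
  (* The lower bound for the maximum keeps [z0] away from 0, from the zeros of p - 1 and from the
     circle, so that ln F is smooth near [z0]. *)
  assert (Hz0n : z0 <> RtoC 0) by (intros ->; rewrite HF0 in HF01; lra).
  assert (Hz0u : unit_disc z0) by (unfold unit_disc; lra).
  assert (Hz0p : 0 < Cmod (p z0 + - (1))%C).
  { destruct (Cmod_ge_0 (p z0 + - (1))%C) as [|E]; [assumption|].
    assert (F z0 = 0) by (unfold F, phi2; rewrite <- E; unfold Rdiv; ring). lra. }
  assert (Hz0r : Cmod z0 < rho).
  { destruct Hz0 as [|E]; [assumption|exfalso].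
    destruct (Hphi0 z0 Hz0u) as [_ Hle].
    assert (F z0 < exp (3 * D / 4)); [|lra].
    unfold F; rewrite E, Hrho2.

    apply Rle_lt_trans with (1 * exp (- beta * (- D / 4) + D / 4 * rho ^ 2)).
    - apply Rmult_le_compat_r; [apply Rlt_le, exp_pos|lra].
    - rewrite Rmult_1_l; apply exp_increasing.
      assert (rho ^ 2 < 1) by nra.
      nra. }
  (* [G] is ln F near [z0], with trivial coefficients kept so that [has_laplacian_lin] applies
     syntactically. Its Laplacian is D/4 * 4 = D > 0. *)
  set (G := fun w => 1 * (1 * (1 * ln (Cmod (p w + - (1))%C ^ 2) + - (1) * ln (Cmod (p w + 1)%C ^ 2))
             + - beta * ln (Cmod (w * 1)%C ^ 2)) + D / 4 * Cmod w ^ 2).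
  assert (Hin : forall w, Cmod (w - z0)%C < rho - Cmod z0 -> unit_disc w).
  { intros w Hw; unfold unit_disc; replace w with (w - z0 + z0)%C by ring.
    eapply Rle_lt_trans; [apply Cmod_triangle|lra]. }
  assert (HG : has_laplacian G z0 (1 * (1 * (1 * 0 + - (1) * 0) + - beta * 0) + D / 4 * 4)).
  { assert (Hd : 0 < rho - Cmod z0) by lra.
    unfold G; apply has_laplacian_lin; [apply has_laplacian_lin; [apply has_laplacian_lin|]|].
    - apply (has_laplacian_ln_sqr_Cmod (fun w => p w + - (1))%C _ _ Hd).
      + intros w Hw; apply Hm1, Hin, Hw.
      + apply Cmod_gt_0, Hz0p.
    - apply (has_laplacian_ln_sqr_Cmod (fun w => p w + 1)%C _ _ Hd).
      + intros w Hw; apply Hp1, Hin, Hw.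
      + apply Cmod_gt_0; generalize (Hge1 z0 Hz0u); lra.
    - apply (has_laplacian_ln_sqr_Cmod (fun w => w * 1)%C _ _ Hd).
      + intros w Hw; apply Hid.
      + rewrite Cmult_1_r; exact Hz0n.
    - apply has_laplacian_sqr_Cmod. }
  assert (HFG : forall w, unit_disc w -> 0 < Cmod (p w + - (1))%C -> F w = exp (G w)).
  { intros w Hw Hw1; unfold F, G, phi2.
    assert (H1 := Hge1 w Hw).
    rewrite <- (exp_ln (_ / _)) by (apply Rdiv_lt_0_compat; apply pow_lt; lra).
    rewrite <- exp_plus, ln_div by (apply pow_lt; lra).
    rewrite Cmult_1_r; f_equal; ring. }
  destruct (locally_C_Cmod z0 (fun w => 0 < Cmod (p w + - (1))%C)) as [d [Hd Hdp]].
  { apply (analytic_at_continuous_Cmod _ _ (Hm1 z0 Hz0u) (fun y => 0 < y)), open_gt, Hz0p. }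
  assert (Hl := has_laplacian_local_max G z0 _ (Rmin d (rho - Cmod z0)) HG).
  assert (1 * (1 * (1 * 0 + - (1) * 0) + - beta * 0) + D / 4 * 4 <= 0); [|lra].
  apply Hl.
  { apply Rmin_pos; lra. }
  intros w Hw.
  assert (Hw1 : Cmod (w - z0)%C < d) by (eapply Rlt_le_trans; [exact Hw|apply Rmin_l]).
  assert (Hw2 : Cmod (w - z0)%C < rho - Cmod z0) by (eapply Rlt_le_trans; [exact Hw|apply Rmin_r]).
  apply exp_le_iff.
  rewrite <- !HFG; auto.
  apply Hmax.
  replace w with (w - z0 + z0)%C by ring.
  eapply Rle_trans; [apply Cmod_triangle|lra].
Qed.

(** * Harnack's lower bound, concavity of ln, and univalence *)

Lemma harnack_lower (p : C -> C) :
  analytic_on unit_disc p -> p (RtoC 0) = RtoC 1 ->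
  (forall z, unit_disc z -> 0 < Re (p z)) ->
  forall z, unit_disc z -> (1 - Cmod z) / (1 + Cmod z) <= Re (p z).
Proof.
  intros Hp Hp0 Hpos z Hz.
  assert (H := schwarz_right_half_plane p Hp Hp0 Hpos z Hz).
  assert (Ha := Hpos z Hz); unfold unit_disc in Hz.
  assert (Hr := Cmod_ge_0 z).
  assert (H2 : Cmod (p z - 1)%C ^ 2 <= (Cmod z * Cmod (p z + 1)%C) ^ 2)
    by (apply pow_incr; split; [apply Cmod_ge_0|exact H]).
  rewrite Rpow_mult_distr, !Cmod2_alt in H2; unfold Cminus in H2.
  rewrite !re_plus, !im_plus, re_opp, im_opp, re_RtoC, im_RtoC in H2.
  rewrite <- Cmod2_alt in H2.
  set (r := Cmod z) in *; set (a := Re (p z)) in *; set (b := Im (p z)) in *.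
  apply Rmult_le_reg_r with (1 + r); [lra|].
  unfold Rdiv; rewrite Rmult_assoc, Rinv_l, Rmult_1_r by lra.
  apply Rnot_lt_le; intros Hlt.
  assert (Hb : 0 <= (1 - r ^ 2) * b ^ 2) by (apply Rmult_le_pos; [nra|apply pow2_ge_0]).
  (* This product is (a - 1)^2 - r^2 (a + 1)^2. Together with (1 - r^2) b^2 >= 0, its positivity
     contradicts the squared Schwarz inequality. *)
  assert (Hq : 0 < (1 - r - a * (1 + r)) * (1 + r - a * (1 - r))).
  { apply Rmult_lt_0_compat; nra. }
  nra.
Qed.

(** The slope of ln over [1, 1 + r] exceeds its slope over [1 + r, 2]. *)
Lemma ln_1_plus_gt (r : R) : 0 < r < 1 -> r * ln 2 < ln (1 + r).
Proof.
  intros Hr.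
  assert (D : forall c, 0 < c -> derivable_pt_lim ln c (/ c))
    by (intros; apply derivable_pt_lim_ln; assumption).
  destruct (MVT_cor2 ln Rinv 1 (1 + r)) as [c [E1 Hc]]; [lra|intros; apply D; lra|].
  destruct (MVT_cor2 ln Rinv (1 + r) 2) as [d [E2 Hd]]; [lra|intros; apply D; lra|].
  rewrite ln_1 in E1.
  assert (Hcd : / d < / c) by (apply Rinv_lt_contravar; [apply Rmult_lt_0_compat|]; lra).
  assert (Hm := Rmult_lt_compat_l (r * (1 - r)) _ _ ltac:(nra) Hcd).
  nra.
Qed.

(** This is the Noshiro-Warschawski criterion on the disc. *)
Lemma univalent_of_Re_derive_pos (f : C -> C) :
  analytic_on unit_disc f ->
  (forall z, unit_disc z -> 0 < Re (C_derive f z)) -> univalent_on unit_disc f.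
Proof.
  intros Hf Hpos z w Hz Hw Hzw.
  destruct (Ceq_dec z w) as [|Hn]; [assumption|exfalso].
  set (e := (z - w)%C).
  assert (He : 0 < Re e ^ 2 + Im e ^ 2).
  { rewrite <- Cmod2_alt; apply pow_lt, Cmod_gt_0; unfold e; intros E.
    apply Hn, Ceq_minus, E. }
  assert (Hseg : forall t, 0 <= t <= 1 -> unit_disc (w + RtoC t * e)%C).
  { intros t Ht; unfold unit_disc in *.
    replace (w + RtoC t * e)%C with (RtoC (1 - t) * w + RtoC t * z)%C
      by (unfold e; rewrite RtoC_minus; ring).
    eapply Rle_lt_trans; [apply Cmod_triangle|].
    rewrite !Cmod_mult, !Cmod_R, !Rabs_pos_eq by lra.
    apply Rle_lt_trans with (Rmax (Cmod w) (Cmod z)); [|apply Rmax_lub_lt; assumption].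
    generalize (Rmax_l (Cmod w) (Cmod z)) (Rmax_r (Cmod w) (Cmod z)); nra. }
  (* [s] is the real part of conj(e) f along the segment; its derivative |e|^2 Re f' is positive, so
     f cannot agree at both ends. *)
  set (s := fun t : R => Re e * Re (f (w + RtoC t * e))%C + Im e * Im (f (w + RtoC t * e))%C).
  destruct (MVT_cor2 s (fun t => (Re e ^ 2 + Im e ^ 2) * Re (C_derive f (w + RtoC t * e))%C) 0 1)
    as [c [E Hc]]; [lra| |].
  - intros t Ht; apply is_derive_Reals.
    destruct (analytic_at_derive _ _ (Hf _ (Hseg t Ht))) as [D _].
    apply is_derive_C_line in D; destruct D as [D1 D2].
    rewrite re_mult in D1; rewrite im_mult in D2.
    set (l := C_derive f (w + RtoC t * e)%C) in *.
    replace ((Re e ^ 2 + Im e ^ 2) * Re l) with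
      (Re e * (Re e * Re l - Im e * Im l) + Im e * (Re e * Im l + Im e * Re l)) by ring.
    apply (is_derive_plus (V := R_NormedModule)); apply is_derive_scal; assumption.
  - unfold s in E.
    replace (w + RtoC 1 * e)%C with z in E by (unfold e; ring).
    replace (w + RtoC 0 * e)%C with w in E by ring.
    rewrite Hzw in E.
    generalize (Rmult_lt_0_compat _ _ He (Hpos _ (Hseg c ltac:(lra)))); lra.
Qed.

Theorem theorem3p2 (f : C -> C)
    (f_analytic : analytic_on unit_disc f)
    (f_0 : f (RtoC 0) = RtoC 0)
    (f'_0 : C_derive f (RtoC 0) = RtoC 1)
    (Re_pos : forall z : C, unit_disc z ->
        Re (C_derive f z + z * C_derive (C_derive f) z)%C > 0) :
  univalent_on unit_disc f /\
  (forall z : C, unit_disc z -> Re (C_derive f z) > 2 * ln 2 - 1).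
Proof.
  assert (f1_an : analytic_on unit_disc (C_derive f))
    by (intros z Hz; apply analytic_at_derive, f_analytic, Hz).
  set (p := fun z => (C_derive f z + z * C_derive (C_derive f) z)%C) in *.
  assert (p_an : analytic_on unit_disc p).
  { intros z Hz; apply analytic_at_plus; [apply f1_an, Hz|].
    apply analytic_at_mult_id, analytic_at_derive, f1_an, Hz. }
  assert (p_0 : p (RtoC 0) = RtoC 1) by (unfold p; rewrite f'_0; ring).
  assert (bound : forall z, unit_disc z -> Re (C_derive f z) > 2 * ln 2 - 1).
  { intros z Hz; unfold unit_disc in Hz.
    destruct (Cmod_ge_0 z) as [Hr|E].
    (* The ray estimate divides by r, so z = 0 is separate: there the claim is 1 > 2 ln 2 - 1, that
       is, 2 < e. *)
    2:{ symmetry in E; apply Cmod_eq_0 in E; subst z; rewrite f'_0, re_RtoC.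
        assert (ln 2 < ln (exp 1)) by (apply ln_increasing; [lra|apply exp_ineq1; lra]).
        rewrite ln_exp in H; lra. }
    set (r := Cmod z) in *.
    assert (Hray : forall t, 0 <= t <= 1 -> Cmod (RtoC 0 + RtoC t * z)%C = t * r).
    { intros t Ht; rewrite Cplus_0_l, Cmod_mult, Cmod_R, Rabs_pos_eq by lra; reflexivity. }
    assert (Hseg : forall t, 0 <= t <= 1 -> unit_disc (RtoC 0 + RtoC t * z)%C).
    { intros t Ht; unfold unit_disc; rewrite Hray by exact Ht; nra. }
    (* [t f'(t z)] has derivative [p (t z)]; the subtracted term is a primitive of
       the Harnack bound [(1 - t r) / (1 + t r)]. *)
    set (psi := fun t => t * Re (C_derive f (RtoC 0 + RtoC t * z)%C)
                  - (2 / r * ln (1 + t * r) - t)).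
    destruct (MVT_cor2 psi (fun t => Re (p (RtoC 0 + RtoC t * z)%C) - (1 - t * r) / (1 + t * r)) 0 1)
      as [c [E Hc]]; [lra| |].
    - intros t Ht; apply is_derive_Reals.
      destruct (analytic_at_derive _ _ (f1_an _ (Hseg t Ht))) as [D _].
      apply is_derive_C_line in D; destruct D as [D _].
      set (g := fun t : R => Re (C_derive f (RtoC 0 + RtoC t * z)%C)) in *.
      assert (0 < 1 + t * r) by nra.
      apply (is_derive_ext (fun t => t * g t - (2 / r * ln (1 + t * r) - t))); [reflexivity|].
      auto_derive.
      + repeat split; [eexists; exact D|assumption].
      + rewrite (is_derive_unique (fun x : R => g x) _ _ D).
        unfold p; rewrite re_plus.
        replace ((RtoC 0 + RtoC t * z) * C_derive (C_derive f) (RtoC 0 + RtoC t * z))%C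
          with (RtoC t * (z * C_derive (C_derive f) (RtoC 0 + RtoC t * z)))%C by ring.
        rewrite re_scal_l; unfold g; field; lra.
    (* The mean value theorem does the work of the integral: [psi] vanishes at 0 and has nonnegative
       derivative at c, so [psi 1] >= 0. *)
    - assert (Hh := harnack_lower p p_an p_0 (fun w Hw => Rgt_lt _ _ (Re_pos w Hw))
                      _ (Hseg c ltac:(lra))).
      rewrite Hray in Hh by lra.
      replace (psi 0) with 0 in E
        by (unfold psi; rewrite !Rmult_0_l, Rplus_0_r, ln_1; ring).
      unfold psi in E.
      replace (RtoC 0 + RtoC 1 * z)%C with z in E by ring.
      rewrite !Rmult_1_l in E.
      assert (Hln := ln_1_plus_gt r (conj Hr Hz)).
      assert (2 * ln 2 < 2 / r * ln (1 + r)).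
      { apply Rmult_lt_reg_l with r; [assumption|].
        replace (r * (2 / r * ln (1 + r))) with (2 * ln (1 + r)) by (field; lra); lra. }
      lra. }
  split; [|exact bound].
  apply univalent_of_Re_derive_pos; [exact f_analytic|].
  (* Since ln 2 > 1/2, the lower bound 2 ln 2 - 1 is positive. *)
  intros z Hz; generalize (bound z Hz) ln_lt_2; lra.
Qed.
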